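(* Let $K$ be a zero-dimensional compact Hausdorff space whose set of isolated points is dense in $K$, and such that the set $K'$ of accumulation points of $K$ is a $G_\delta$ subset of $K$. Let $F:B_{C(K)}\to B_{C(K)}$ be a non-expansive bijection. Then $F$ is an isometry under either of the following additional assumptions: (i) $F$ has property $( * )$: for any $u,v,z\in K$ with $u\neq v$ and any sign $\omega\in\{-1,1\}$, there exists $f\in B_{C(K)}$ such that $f(u)f(v)$ is non-zero with sign $\omega$ and $|F(f)|\equiv 1$ on some neighbourhood of $z$; (ii) $\inf\{\|F(\omega\mathds{1}_{\{a\}})\| : a\in K\setminus K',\ \omega=\pm1\}>1/2$.
   Context: $C(K)$ is the Banach space of real-valued continuous functions on $K$ with the supremum norm and $B_{C(K)}$ its closed unit ball. A topological space is zero-dimensional if it has a basis of clopen sets. A map is non-expansive if it is $1$-Lipschitz. $\mathds{1}_{\{a\}}$ is the indicator function of $\{a\}$ (continuous when $a$ is isolated). *)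

(* Defs.v *)
From HB Require Import structures.
From mathcomp Require Import all_boot all_order all_algebra.
From mathcomp Require Import all_classical all_reals all_analysis.
From mathcomp Require Export borel_hierarchy.
Set Implicit Arguments. Unset Strict Implicit. Unset Printing Implicit Defensive.
Import Order.TTheory GRing.Theory Num.Theory.
Import numFieldNormedType.Exports.
Local Open Scope classical_set_scope.
Local Open Scope ring_scope.

(* Zero-dimensional in the paper's sense: a basis of clopen sets. *)
Definition clopen_basis (T : topologicalType) :=
  forall (x : T) (U : set T), open U -> U x ->
    exists V : set T, [/\ clopen V, V x & V `<=` U].

Definition isolated_pt (T : topologicalType) (x : T) := nbhs x [set x].

Definition accum_pts (T : topologicalType) : set T := [set x | ~ isolated_pt x].

Record BC (R : realType) (K : topologicalType) := MkBC {
  bc_fun :> K -> R ;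
  bc_cont : continuous bc_fun ;
  bc_le1 : forall x, `|bc_fun x| <= 1 }.

Definition supdist (R : realType) (K : topologicalType) (f g : K -> R) : R :=
  sup [set `|f x - g x| | x in [set: K]].

Definition supnorm (R : realType) (K : topologicalType) (f : K -> R) : R :=
  sup [set `|f x| | x in [set: K]].

Definition bc_non_expansive (R : realType) (K : topologicalType)
  (F : BC R K -> BC R K) :=
  forall f g, supdist (F f) (F g) <= supdist f g.

Definition bc_isometry (R : realType) (K : topologicalType)
  (F : BC R K -> BC R K) :=
  forall f g, supdist (F f) (F g) = supdist f g.

Definition property_star (R : realType) (K : topologicalType)
  (F : BC R K -> BC R K) :=
  forall (u v z : K) (w : R), u <> v -> (w = 1 \/ w = -1) ->
    exists f : BC R K,
      0 < w * (f u * f v) /\ \forall y \near z, `|F f y| = 1.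

Definition cond_ii (R : realType) (K : topologicalType)
  (F : BC R K -> BC R K) :=
  exists2 c : R, 1 / 2 < c &
    forall (a : K) (w : R) (g : BC R K), isolated_pt a -> (w = 1 \/ w = -1) ->
      (forall x, g x = if x == a then w else 0) ->
      c <= supnorm (F g).

(* Main.v *)
(**
Write G for the inverse of F and E for the set of continuous functions of constant
modulus 1. Since the midpoint of 0 and y is unique exactly when y lies in E, G maps
E into E. For an isolated point b and y in E, the function y is within distance 1
of F(1_b) or of F(-1_b), according to the sign of G y at b; as y is arbitrary, both
images live on a single isolated point sigma(b), with opposite signs. Hence
G y = e (y o sigma) on E for some e in E, and sigma extends to a continuous self-map
of K that is injective on the isolated points. Put J h = e (h o sigma).

It remains to see that F(J h) = h for all h, for then J inverts F and F is an
isometry. Suppose that |F f(sigma b)| > d forces f(b) to have the right sign. A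
function y q with y in E and q > d is approximated by y p, where p takes distinct
values on the (countably many) isolated points and well-orders them; then
F(J(y p)) = y p by induction along this order, comparing with the functions that
agree with y p on an initial segment and with y elsewhere. Under (ii) this applies
with some d < 1, so F(J g) = g for g small, which makes J surjective; under (i) sigma is
injective, so J is again surjective. Once J is surjective one can take d = 0, and
nowhere vanishing functions are dense.
*)
Require Import Defs.
From HB Require Import structures.
From mathcomp Require Import all_boot all_order all_algebra.
From mathcomp Require Import all_classical all_reals all_analysis.
From mathcomp Require Import borel_hierarchy.
From mathcomp Require Import ring lra.
Set Implicit Arguments.
Unset Strict Implicit.
Unset Printing Implicit Defensive.
Import Order.TTheory GRing.Theory Num.Theory.
Import numFieldNormedType.Exports.
Local Open Scope classical_set_scope.
Local Open Scope ring_scope.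

(** * Clopen sets and isolated points *)

Section topology.
Context {K : topologicalType}.
Implicit Types (A C U : set K) (x a : K).

Lemma clopen_if_continuous {T : topologicalType} C (f g : K -> T) :
  clopen C -> continuous f -> continuous g ->
  continuous (fun x => if `[< C x >] then f x else g x).
Proof.
move=> [oC cC] cf cg x; rewrite /continuous_at.
have [Cx|Cx] := pselect (C x).
  rewrite asboolT//; apply: (@cvg_trans _ (f @ x)); last exact: cf.
  apply: near_eq_cvg.
  have : nbhs x C by apply: open_nbhs_nbhs.
  by apply: filterS => y Cy; rewrite asboolT.
rewrite asboolF//; apply: (@cvg_trans _ (g @ x)); last exact: cg.
apply: near_eq_cvg.
have : nbhs x (~` C) by apply: open_nbhs_nbhs; split => //; exact: closed_openC.
by apply: filterS => y Cy; rewrite asboolF.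
Qed.

Lemma finite_isolated_clopen A : hausdorff_space K ->
  finite_set A -> A `<=` @isolated_pt K -> clopen A.
Proof.
move=> hK fA Ai; split; last first.
  by have /accessible_finite_set_closed := hausdorff_accessible hK; exact.
rewrite openE => x Ax; apply: (filterS _ (Ai _ Ax)).
by move=> _ ->.
Qed.

Lemma isolated_clopen a : hausdorff_space K -> isolated_pt a -> clopen [set a].
Proof.
by move=> hK ia; apply: finite_isolated_clopen => // _ ->.
Qed.

(** Otherwise the sets [A \ C], with [C] clopen inside [U], generate a proper filter on the compact
    set [A]; a cluster point has a clopen neighbourhood inside [U], which is impossible. *)
Lemma clopen_separation A U : compact [set: K] -> clopen_basis K ->
  closed A -> open U -> A `<=` U ->
  exists C, [/\ clopen C, A `<=` C & C `<=` U].
Proof.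
move=> cK bK cA oU AU; apply: contrapT => noC.
pose B : set (set K) := [set C | clopen C /\ C `<=` U].
pose G : set_system K := filter_from B (fun C => A `\` C).
have compA : compact A by exact: subclosed_compact cA cK _.
have PG : ProperFilter G.
  apply: filter_from_proper.
    apply: filter_from_filter; first by exists set0; split => //; exact: clopen0.
    move=> C1 C2 [cl1 s1] [cl2 s2]; exists (C1 `|` C2).
      split; last by move=> x [/s1|/s2].
      by case: cl1 cl2 => ? ? [? ?]; split; [exact: openU|exact: closedU].
    by move=> x [Ax nC]; split; split => // ?; apply: nC; [left|right].
  move=> C [clC sC]; apply: contrapT => nA; apply: noC; exists C; split => //.
  by move=> x Ax; apply: contrapT => nCx; apply: nA; exists x.
have GA : G A.
  exists set0; last by move=> x [].
  by split => //; exact: clopen0.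
have [x [Ax clx]] := compA G PG GA.
have [V [clV Vx VU]] := bK x U oU (AU _ Ax).
have GV : G (A `\` V) by exists V.
have nV : nbhs x V by apply: open_nbhs_nbhs; split => //; case: clV.
by have [y [[_ nVy] Vy]] := clx _ _ GV nV.
Qed.

Hypothesis iso_dense : dense [set x : K | isolated_pt x].

Lemma isolated_near x U : nbhs x U -> exists2 b, isolated_pt b & U b.
Proof.
move=> /nbhs_interior Ux.
have [|b [Ub ib]] := iso_dense _ (@open_interior _ U).
  by exists x; exact: nbhs_singleton.
by exists b => //; exact: interior_subset.
Qed.

Lemma le_of_le_isolated {R : realType} (f g : K -> R) : continuous f -> continuous g ->
  (forall b, isolated_pt b -> f b <= g b) -> forall x, f x <= g x.
Proof.
move=> cf cg fg x; rewrite leNgt; apply/negP => gfx.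
have /isolated_near[b ib] : nbhs x [set z | 0 < f z - g z].
  have h : (f z - g z) @[z --> x] --> f x - g x.
    by apply: cvgB; [exact: cf|exact: cg].
  by apply: (cvgr_gt _ h); rewrite subr_gt0.
by rewrite /= subr_gt0 ltNge fg.
Qed.

(** The complement of each [U i] is compact and consists of isolated points, hence is finite. *)
Lemma isolated_countable : compact [set: K] -> hausdorff_space K ->
  Gdelta (@accum_pts K) -> countable [set x : K | isolated_pt x].
Proof.
move=> cK hK [U oU accE].
have -> : [set x : K | isolated_pt x] = \bigcup_i ~` U i.
  rewrite -setC_bigcap -accE; apply/seteqP; split => x /=; first by move=> ? [].
  by move=> /contrapT.
apply: bigcup_countable => // i _; apply: finite_set_countable.
have cU : compact (~` U i).
  by apply: (subclosed_compact (open_closedC (oU i)) cK).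
have Ui x : (~` U i) x -> isolated_pt x.
  move=> nUx; apply: contrapT => nix; apply: nUx.
  have : accum_pts x by [].
  by rewrite accE; exact.
apply: contrapT => infU.
pose G : set_system K := filter_from (@finite_set K) (fun B => ~` U i `\` B).
have PG : ProperFilter G.
  apply: filter_from_proper.
    apply: filter_from_filter; first by exists set0; exact: finite_set0.
    move=> B1 B2 f1 f2; exists (B1 `|` B2); first by rewrite finite_setU.
    by move=> x [Ax nB]; split; split => // ?; apply: nB; [left|right].
  move=> B fB; apply: contrapT => nB; apply: infU; apply: sub_finite_set fB.
  by move=> x Ax; apply: contrapT => nBx; apply: nB; exists x.
have [|x [nUx clx]] := cU G PG.
  by exists set0; [exact: finite_set0|move=> x []].
have Gx : G (~` U i `\` [set x]) by exists [set x] => //; exact: finite_set1.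
by have [y [[_ nyx] yx]] := clx _ _ Gx (Ui _ nUx).
Qed.

End topology.

(** * The unit ball of C(K) *)

Section unit_ball.
Context {R : realType} {K : topologicalType}.
Implicit Types (f g h y : BC R K) (C : set K) (x a : K).

Lemma bc_ext f g : (forall x, f x = g x) -> f = g.
Proof.
case: f g => [f cf bf] [g cg bg] /= /funext fg; case: _ / fg in cg bg *.
by rewrite (Prop_irrelevance cf cg) (Prop_irrelevance bf bg).
Qed.

Lemma supdist_has_ubound f g : has_ubound [set `|f x - g x| | x in [set: K]].
Proof.
exists 2 => _ [x _ <-]; rewrite (le_trans (ler_normB _ _))//.
by rewrite (_ : 2 = 1 + 1)// lerD// bc_le1.
Qed.

Lemma supdist_ge f g x : `|f x - g x| <= supdist f g.
Proof. by apply: ub_le_sup; [exact: supdist_has_ubound|exists x]. Qed.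

Lemma supdist_le (f g : K -> R) c : 0 <= c ->
  (forall x, `|f x - g x| <= c) -> supdist f g <= c.
Proof.
move=> c0 fgc; rewrite /supdist.
(* [K] may be empty; the supremum is then 0, whence the assumption on [c]. *)
have [->|/set0P S0] := eqVneq [set `|f x - g x| | x in [set: K]] set0.
  by rewrite sup0.
by apply: sup_le_ub => //= _ [x _ <-].
Qed.

Lemma supdist_attained f g x0 : compact [set: K] ->
  exists x, supdist f g = `|f x - g x|.
Proof.
move=> cK; have cfg : continuous (fun x => `|f x - g x|).
  by move=> x; apply: cvg_norm; apply: cvgB; exact: bc_cont.
have [|x _ xmax] := compact_EVT_max (A := [set: K]) _ cK (continuous_subspaceT cfg).
  by exists x0.
exists x; apply/eqP; rewrite eq_le supdist_ge andbT; apply: supdist_le => // z.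
by apply: xmax; rewrite inE.
Qed.

Lemma bc_cst (c : R) : `|c| <= 1 -> exists f, forall x, f x = c.
Proof. by move=> c1; exists (@MkBC R K (cst c) (@cst_continuous _ _ c) (fun=> c1)). Qed.

Lemma bc_if C f g : clopen C ->
  exists h, forall x, h x = if `[< C x >] then f x else g x.
Proof.
move=> clC; have h1 x : `|if `[< C x >] then f x else g x| <= 1.
  by case: ifP => _; exact: bc_le1.
by exists (MkBC (clopen_if_continuous clC (@bc_cont _ _ f) (@bc_cont _ _ g)) h1).
Qed.

Lemma bc_mul f g : exists h, forall x, h x = f x * g x.
Proof.
have h1 x : `|f x * g x| <= 1 by rewrite normrM mulr_ile1// bc_le1.
have hc : continuous (fun x => f x * g x).
  by move=> x; apply: cvgM; exact: bc_cont.
by exists (MkBC hc h1).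
Qed.

Definition sign_fun y := forall x, y x = 1 \/ y x = -1.

Lemma sign_fun_sqr y x : sign_fun y -> y x * y x = 1.
Proof. by move=> /(_ x)[]->; lra. Qed.

Lemma sign_funP y x : sign_fun y -> `|y x| = 1.
Proof. by move=> /(_ x)[]->; rewrite ?normrN normr1. Qed.

Lemma sign_fun_clopen C : clopen C ->
  exists2 y, sign_fun y & forall x, y x = if `[< C x >] then 1 else -1.
Proof.
move=> clC.
have [f1 f1E] : exists f, forall x, f x = 1 by apply: bc_cst; rewrite normr1.
have [fN fNE] : exists f, forall x, f x = -1 by apply: bc_cst; rewrite normrN normr1.
have [h hE] := bc_if f1 fN clC.
by exists h => x; rewrite hE f1E fNE//; case: ifP; [left|right].
Qed.

Section hausdorff.
Hypothesis hK : hausdorff_space K.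

Lemma bc_update f a (t : R) : isolated_pt a -> `|t| <= 1 ->
  exists h, forall x, h x = if x == a then t else f x.
Proof.
move=> ia t1; have [g gE] := bc_cst t1.
have [h hE] := bc_if g f (isolated_clopen hK ia).
exists h => x; rewrite hE gE; congr (if _ then _ else _).
by apply/asboolP/eqP.
Qed.

Lemma bc_point a (t : R) : isolated_pt a -> `|t| <= 1 ->
  exists h, forall x, h x = if x == a then t else 0.
Proof.
move=> ia t1; have [|z zE] := @bc_cst 0; first by rewrite normr0.
have [h hE] := bc_update z ia t1.
by exists h => x; rewrite hE zE.
Qed.

Lemma sign_fun_update y a (w : R) : sign_fun y -> isolated_pt a ->
  (w = 1 \/ w = -1) ->
  exists2 h, sign_fun h & forall x, h x = if x == a then w else y x.
Proof.
move=> sy ia ww; have [|h hE] := @bc_update y a w ia.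
  by case: ww => ->; rewrite ?normrN normr1.
by exists h => // x; rewrite hE; case: ifP.
Qed.

End hausdorff.

Section zero_dimensional.
Hypotheses (cK : compact [set: K]) (bK : clopen_basis K).

Lemma clopen_level (q : K -> R) (a b : R) : continuous q -> a < b ->
  exists C, [/\ clopen C, (forall x, b <= q x -> C x) & forall x, C x -> a < q x].
Proof.
move=> cq ab.
have cA : closed [set x | b <= q x].
  exact: (continuous_closedP q).1 cq _ (@closed_ge R b).
have oU : open [set x | a < q x].
  exact: (continuousP q).1 cq _ (@open_gt R a).
have [|C [clC AC CU]] := clopen_separation cK bK cA oU.
  by move=> x /=; exact: lt_le_trans.
by exists C; split.
Qed.

(** A clopen set between [f >= e] and [f > - e] replaces the possibly discontinuous sign of [f]. *)
Lemma almost_sign f (e : R) : 0 < e ->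
  exists2 y, sign_fun y & forall x, - e <= f x * y x.
Proof.
move=> e0; have [|C [clC AC CU]] := @clopen_level f (- e) e (@bc_cont _ _ f).
  by lra.
have [y sy yE] := sign_fun_clopen clC; exists y => // x; rewrite yE.
case: asboolP => [/CU|nC]; first by lra.
have : ~ e <= f x by move=> /AC.
by move=> /negP; rewrite -ltNge; lra.
Qed.

(** [s] adds up the indicators of clopen sets between [q >= (j+1)/N] and [q > j/N] for [j < k]; the
    alternatives [s x = 0] and [s x = k] account for values of [q] outside [[0, k/N]]. *)
Lemma step_approx (q : K -> R) (N : R) : continuous q -> 0 < N -> forall k : nat,
  exists s : K -> nat, (forall x, \forall z \near x, s z = s x) /\
    forall x, [/\ (s x <= k)%N, (s x)%:R <= N * q x + 1 \/ s x = 0%N &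
      N * q x - 1 <= (s x)%:R \/ s x = k].
Proof.
move=> cq N0; elim=> [|k [s [sloc sP]]].
  exists (fun=> 0%N); split; first by move=> x; exact: nearW.
  by move=> x; split; [|right|right].
have [|C [clC AC CU]] := @clopen_level q (k%:R / N) (k.+1%:R / N) cq.
  by rewrite ltr_pM2r ?invr_gt0// ltr_nat.
exists (fun x => s x + `[< C x >])%N; split => [x|x].
  have Cloc : \forall z \near x, `[< C z >] = `[< C x >].
    have [Cx|nCx] := pselect (C x).
      have : nbhs x C by apply: open_nbhs_nbhs; split => //; case: clC.
      by apply: filterS => z Cz; rewrite !asboolT.
    have : nbhs x (~` C).
      by apply: open_nbhs_nbhs; split => //; apply: closed_openC; case: clC.
    by apply: filterS => z Cz; rewrite !asboolF.
  by apply: filterS2 (sloc x) Cloc => z -> ->.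
have [sk s1 s2] := sP x; case: asboolP => [/CU|nC].
  rewrite ltr_pdivrMr// => kq; rewrite addn1; split => //.
    left; have : (s x)%:R <= k%:R :> R by rewrite ler_nat.
    by rewrite -natr1; lra.
  by case: s2 => [s2|->]; [left; rewrite -natr1; lra|right].
have : ~ k.+1%:R / N <= q x by move=> /AC.
move=> /negP; rewrite -ltNge ltr_pdivlMr// -natr1 => qk.
rewrite addn0; split => //; first exact: leqW.
by left; case: s2 => [//|->]; lra.
Qed.

End zero_dimensional.
End unit_ball.

(** * Approximation by functions that well-order the isolated points *)

Lemma argmin_nat {T : Type} (A : set T) (m : T -> nat) : A !=set0 ->
  exists2 a, A a & forall b, A b -> (m a <= m b)%N.
Proof.
move=> [a0 Aa0].
have ex : exists n, `[< exists2 a, A a & m a = n >].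
  by exists (m a0); apply/asboolP; exists a0.
case: (ex_minnP ex) => _ /asboolP[a Aa <-] mmin; exists a => // b Ab.
by apply: mmin; apply/asboolP; exists b.
Qed.

Section perturbation.
Context {R : realType} {K : topologicalType}.
Hypotheses (cK : compact [set: K]) (hK : hausdorff_space K).
Hypotheses (bK : clopen_basis K) (KG : Gdelta (@accum_pts K)).

(* A continuous function vanishing exactly on the accumulation points and
   injective on the isolated ones; this is where the Gdelta assumption enters. *)
Lemma isolated_weight : exists w : K -> R, exists n : K -> nat,
  [/\ continuous w, (forall x, 0 <= w x <= 1),
      (forall a b, isolated_pt a -> isolated_pt b -> n a = n b -> a = b),
      (forall x, w x = if `[< isolated_pt x >] then (n x).+1%:R^-1 else 0) &
      forall m, finite_set [set x | isolated_pt x /\ (n x < m)%N]].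
Proof.
have /countable_injP[n ninj] := isolated_countable cK hK KG.
have nI a b : isolated_pt a -> isolated_pt b -> n a = n b -> a = b.
  by move=> ia ib; apply: ninj; rewrite inE.
have nfin m : finite_set [set x | isolated_pt x /\ (n x < m)%N].
  elim: m => [|m IH]; first by apply: (sub_finite_set _ (@finite_set0 K)) => x [].
  have [[a [ia am]]|nom] := pselect (exists a, isolated_pt a /\ n a = m).
    apply: (@sub_finite_set _ _ ([set x | isolated_pt x /\ (n x < m)%N] `|` [set a])).
      move=> x [ix]; rewrite ltnS leq_eqVlt => /orP[/eqP nxm|nxm]; last by left.
      by right; apply: nI => //; rewrite am.
    by rewrite finite_setU; split => //; exact: finite_set1.
  apply: sub_finite_set IH => x [ix]; rewrite ltnS leq_eqVlt => /orP[/eqP nxm|//].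
  by exfalso; apply: nom; exists x.
pose w x : R := if `[< isolated_pt x >] then (n x).+1%:R^-1 else 0.
have w01 x : 0 <= w x <= 1.
  rewrite /w; case: ifP => _; last by rewrite lexx ler01.
  by rewrite invr_ge0 ler0n /= invf_le1 ?ltr0n// ler1n.
exists w, n; split => // x.
have [ix|nix] := pselect (isolated_pt x).
  apply: (near_cst_continuous (w x)).
  by apply: filterS ix => z ->.
have wx : w x = 0 by rewrite /w asboolF.
rewrite /continuous_at wx; apply/cvgr0Pnorm_lt => e e0.
(* Isolated points of weight at least [e] all lie in this finite closed set, which misses [x]. *)
have [_ cF] := finite_isolated_clopen hK (nfin (Num.bound e^-1)) (fun x h => h.1).
have : nbhs x (~` [set x | isolated_pt x /\ (n x < Num.bound e^-1)%N]).
  by apply: open_nbhs_nbhs; split; [exact: closed_openC|move=> []].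
apply: filterS => z /= nz; have [wz0 _] := andP (w01 z); rewrite ger0_norm//.
rewrite /w; case: asboolP => // iz.
have : (Num.bound e^-1 <= n z)%N.
  by rewrite leqNgt; apply/negP => ?; apply: nz.
rewrite -(ler_nat R) => bn.
rewrite invf_plt ?posrE ?ltr0n//.
apply: lt_trans (_ : (n z)%:R < _); last by rewrite ltr_nat.
apply: lt_le_trans bn; apply: archi_boundP; rewrite invr_ge0; exact: ltW.
Qed.

Lemma clopen_locally_constant {T : Type} (s : K -> T) (A : set T) :
  (forall x, \forall z \near x, s z = s x) -> clopen [set x | A (s x)].
Proof.
have oA (B : set T) : (forall x, \forall z \near x, s z = s x) -> open [set x | B (s x)].
  by move=> sloc; rewrite openE => x /= Bx; apply: filterS (sloc x) => z /= ->.
move=> sloc; split; first exact: oA.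
by rewrite -openC; apply: (oA (~` A)).
Qed.

(** The order is lexicographic: first by a step function [s], then by the index [n]; the correction
    [w / 2 < 1] never disturbs the first comparison. Accumulation points have [w = 0] and come last
    in their level, so an initial segment is a union of levels and a finite set of isolated
    points. *)
Lemma well_ordered_approx (q : K -> R) (e : R) : continuous q ->
  (forall x, 0 <= q x <= 1) -> 0 < e ->
  exists p : K -> R, [/\ continuous p, forall x, `|q x - p x| <= e,
    forall x, p x <= 1,
    forall a, isolated_pt a ->
      clopen [set x | p x < p a] /\ forall x, p x = p a -> x = a &
    forall A : set K, A !=set0 -> A `<=` @isolated_pt K ->
      exists2 a, A a & forall b, A b -> p a <= p b].
Proof.
move=> cq q01 e0.
have [w [n [cw w01 nI wE nfin]]] := isolated_weight.
(* [2 / N <= e] covers the step error 1 and the correction 1/2; as [N * q <= M], stopping at [M]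
   levels is harmless. *)
pose M := (Num.bound (2 / e)).+1; pose N : R := M%:R.
have N0 : 0 < N by rewrite ltr0n.
have Ne : 2 <= e * N.
  rewrite -ler_pdivrMl// mulrC; apply: ltW.
  apply: (@lt_trans _ _ (Num.bound (2 / e))%:R); last by rewrite ltr_nat.
  by apply: archi_boundP; rewrite divr_ge0// ltW.
have [s [sloc sP]] := step_approx cK bK cq N0 M.
pose p x : R := ((s x)%:R - w x / 2) / N.
have cs : continuous (fun x => (s x)%:R : R).
  move=> x; apply: (near_cst_continuous ((s x)%:R : R)).
  by apply: filterS (sloc x) => z ->.
have ple x z : (p x <= p z) = ((s x)%:R - w x / 2 <= (s z)%:R - w z / 2).
  by rewrite /p ler_pM2r// invr_gt0.
have plt x z : (p x < p z) = ((s x)%:R - w x / 2 < (s z)%:R - w z / 2).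
  by rewrite /p ltr_pM2r// invr_gt0.
have slt x z : (s x < s z)%N -> p x < p z.
  rewrite plt -(ler_nat R) -natr1 => sxz.
  by have := w01 x; have := w01 z; lra.
exists p; split.
- move=> x; apply: cvgM; last exact: cvg_cst.
  apply: cvgB; first exact: cs.
  by apply: cvgM; [exact: cw|exact: cvg_cst].
- move=> x; have [sM s1 s2] := sP x.
  have -> : q x - p x = (N * q x - (s x)%:R + w x / 2) / N.
    by rewrite /p; field; rewrite gt_eqF.
  rewrite normrM normfV (gtr0_norm N0) ler_pdivrMr//; apply: le_trans Ne.
  have := w01 x; have := q01 x.
  have {}s1 : (s x)%:R <= N * q x + 1.
    case: s1 => // ->; have /andP[qx0 _] := q01 x.
    by rewrite addr_ge0// mulr_ge0// ltW.
  have {}s2 : N * q x - 1 <= (s x)%:R.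
    case: s2 => // ->; have : N * q x <= N * 1 by rewrite ler_pM2l//; case/andP: (q01 x).
    by rewrite -/N; lra.
  by rewrite ler_norml; lra.
- move=> x; have [sM _ _] := sP x.
  rewrite /p ler_pdivrMr// mul1r; have := w01 x.
  have : (s x)%:R <= N by rewrite ler_nat.
  by lra.
- move=> a ia; have wa : 0 < w a by rewrite wE asboolT// invr_gt0 ltr0n.
  have seq x : p x = p a -> s x = s a.
    move=> pxa; apply/eqP; rewrite eqn_leq.
    by apply/andP; split; rewrite leqNgt; apply/negP => /slt; rewrite pxa ltxx.
  split; last first.
    move=> x pxa; have sxa := seq _ pxa.
    have : w x = w a.
      have /eqP := pxa; rewrite /p sxa; move/eqP/mulIf.
      by rewrite invr_eq0 gt_eqF// => /(_ isT); lra.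
    rewrite [w a]wE [w x]wE (asboolT ia); case: asboolP => [ix|_ h]; last first.
      by exfalso; move: wa; rewrite wE asboolT// -h ltxx.
    by move/invr_inj/eqP; rewrite eqr_nat eqSS => /eqP; exact: nI.
  have [op2 c2] : clopen [set x | isolated_pt x /\ (n x < n a)%N].
    by apply: finite_isolated_clopen => // x [].
  have [op3 c3] := clopen_locally_constant [set m | m = s a] sloc.
  have [op1 c1] := clopen_locally_constant [set m | (m < s a)%N] sloc.
  rewrite (_ : mkset _ = [set x | (s x < s a)%N] `|`
      ([set x | s x = s a] `&` [set x | isolated_pt x /\ (n x < n a)%N])).
    by split; [apply: openU => //; exact: openI|apply: closedU => //; exact: closedI].
  apply/seteqP; split => x /=.
    move=> pxa; have [sxa|sxa|sxa] := ltngtP (s x) (s a).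
    + by left.
    + by move: (slt _ _ sxa); rewrite ltNge (ltW pxa).
    + right; split => //; move: pxa; rewrite plt sxa => pxa.
      have {}pxa : w a < w x by lra.
      move: pxa; rewrite [w a]wE [w x]wE (asboolT ia); case: asboolP => [ix|_].
        by rewrite ltf_pV2 ?posrE ?ltr0n// ltr_nat ltnS.
      by rewrite ltNge invr_ge0 ler0n.
  move=> [/slt //|[sxa [ix nxa]]]; rewrite plt sxa ltrD2l ltrN2.
  rewrite ltr_pM2r ?invr_gt0// [w a]wE [w x]wE !asboolT//.
  by rewrite ltf_pV2 ?posrE ?ltr0n// ltr_nat ltnS.
- move=> A A0 Ai; have [b Ab bmin] := argmin_nat s A0.
  have [|a [Aa sa] amin] := @argmin_nat _ (A `&` [set x | s x = s b]) n.
    by exists b.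
  exists a => // c Ac; have := bmin _ Ac; rewrite leq_eqVlt => /orP[/eqP sbc|sbc].
    rewrite ple sa sbc lerD2l lerN2 ler_pM2r ?invr_gt0//.
    rewrite [w a]wE [w c]wE !asboolT//; [|exact: Ai..].
    rewrite lef_pV2 ?posrE ?ltr0n// ler_nat ltnS; apply: amin; split => //.
  by apply/ltW/slt; rewrite sa.
Qed.

End perturbation.

(** * The action of F on points and signs *)

Section representation.
Context {R : realType} {K : topologicalType}.
Hypotheses (cK : compact [set: K]) (hK : hausdorff_space K).
Hypotheses (bK : clopen_basis K) (dK : dense [set x : K | isolated_pt x]).
Context {F G : BC R K -> BC R K}.
Hypotheses (Fne : bc_non_expansive F) (FK : cancel F G) (GK : cancel G F).
Implicit Types (f g h y : BC R K) (a b x : K) (c t : R).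

Lemma nonexp_le f g c : 0 <= c -> (forall x, `|f x - g x| <= c) ->
  forall x, `|F f x - F g x| <= c.
Proof.
move=> c0 fg x; apply: le_trans (supdist_ge _ _ x) _.
exact: le_trans (Fne f g) (supdist_le c0 fg).
Qed.

(** The constants 1 and -1 have preimages within 1 of [f = 0], so [F f] is within 1 of both. *)
Lemma nonexp0 f : (forall x, f x = 0) -> forall x, F f x = 0.
Proof.
move=> f0 x.
have Fle g : `|F g x - F f x| <= 1.
  by apply: nonexp_le => // z; rewrite f0 subr0 bc_le1.
have [g1 g1E] : exists g, forall x, g x = 1 by apply: bc_cst; rewrite normr1.
have [g2 g2E] : exists g, forall x, g x = -1 by apply: bc_cst; rewrite normrN normr1.
have := Fle (G g1); have := Fle (G g2); rewrite !GK g1E g2E !ler_norml.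
by move=> /andP[? ?] /andP[? ?]; apply: le_anti; lra.
Qed.

Lemma nonexp_norm_le f c : 0 <= c -> (forall x, `|f x| <= c) ->
  forall x, `|F f x| <= c.
Proof.
move=> c0 fc x; have [|z zE] := @bc_cst R K 0; first by rewrite normr0.
have := @nonexp_le f z c c0 _ x; rewrite (nonexp0 zE) subr0; apply.
by move=> w; rewrite zE subr0.
Qed.

(** [F h] lies within 1/2 of both 0 and [y], and [y / 2] is the only such function since
    [|y| = 1]. *)
Lemma half_image y h : sign_fun y -> (forall x, `|h x| <= 2^-1) ->
  (forall x, `|G y x - h x| <= 2^-1) -> forall x, F h x = y x / 2.
Proof.
move=> sy h1 h2 x; have h20 : 0 <= 2^-1 :> R by rewrite invr_ge0.
have := nonexp_norm_le h20 h1 x; have := nonexp_le h20 h2 x.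
by rewrite GK !ler_norml; case: (sy x) => ->; lra.
Qed.

(* If [`|G y|] were not identically 1, two distinct points would be metric
   midpoints of [0] and [G y], while [y / 2] is the only midpoint of [0] and [y]. *)
Lemma sign_preimage y : sign_fun y -> sign_fun (G y).
Proof.
move=> sy x; set f := G y.
have [h hE] : exists h, forall x, h x = f x / 2.
  have [|c cE] := @bc_cst R K 2^-1; first by rewrite ger0_norm; lra.
  by have [h hE] := bc_mul f c; exists h => z; rewrite hE cE.
have fle z : -1 <= f z <= 1 by rewrite -ler_norml bc_le1.
have nlt : ~ `|f x| < 1.
  move=> fx1; have /(isolated_near dK)[b ib fb1] : nbhs x [set z | `|f z| < 1].
    have cvf : `|f z| @[z --> x] --> `|f x| by apply: cvg_norm; exact: bc_cont.
    exact: (cvgr_lt _ cvf).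
  have {}fb1 : -1 < f b < 1 by rewrite -ltr_norml.
  (* This makes [h' b] equal to 1/2 or -1/2, with the sign of [f b]: still within 1/2 of 0 and of
     [f b], but different from [f b / 2] because [|f b| < 1]. *)
  pose w := if 0 <= f b then 1 - f b else - 1 - f b.
  have [|h' h'E] := @bc_update R K hK h b (f b / 2 + w / 2) ib.
    by rewrite ler_norml /w; case: ifP => [|/negbT]; rewrite -?ltNge; lra.
  have : F h = F h'.
    apply: bc_ext => z; rewrite !(half_image sy)// => {}z; rewrite ?h'E ?hE -/f ler_norml.
    - case: eqP => [_|_]; last by have := fle z; lra.
      by rewrite /w; case: ifP => [|/negbT]; rewrite -?ltNge; lra.
    - case: eqP => [->|_]; last by have := fle z; lra.
      by rewrite /w; case: ifP => [|/negbT]; rewrite -?ltNge; lra.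
    - by have := fle z; lra.
    - by have := fle z; lra.
  move=> /(congr1 G); rewrite !FK => /(congr1 (fun g : BC R K => g b)).
  rewrite h'E eqxx hE /w; case: ifP => [|/negbT]; rewrite -?ltNge; lra.
have : `|f x| = 1.
  by apply/eqP; rewrite eq_le bc_le1 leNgt; apply/negP.
by move/eqP; rewrite eqr_norml ler01 andbT => /orP[]/eqP; [left|right].
Qed.

(** [f] is within 1 of [G y]: at [b] the signs agree, elsewhere [f = 0]. So [F f] is within 1 of
    [y], which excludes opposite signs. *)
Lemma point_sign_ge0 f b t y : (forall x, f x = if x == b then t else 0) ->
  `|t| <= 1 -> sign_fun y -> 0 <= t * G y b -> forall x, 0 <= F f x * y x.
Proof.
move=> fE t1 sy tG x; have t11 : -1 <= t <= 1 by rewrite -ler_norml.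
have : `|F f x - F (G y) x| <= 1.
  apply: nonexp_le => // z; rewrite fE; case: eqP => [->|_].
    by case: (sign_preimage sy b) => yb; rewrite yb in tG *; rewrite ler_norml; lra.
  by rewrite sub0r normrN bc_le1.
by rewrite GK ler_norml; case: (sy x) => ->; lra.
Qed.

Lemma sign_neg (r : R) : r != 0 -> exists2 w, w = 1 \/ w = -1 & r * w < 0.
Proof.
by case: ltgtP => // r0 _; [exists 1; [left|]|exists (-1); [right|]]; lra.
Qed.

Lemma opposite_points b t t' f f' y :
  (forall x, f x = if x == b then t else 0) ->
  (forall x, f' x = if x == b then t' else 0) ->
  `|t| <= 1 -> `|t'| <= 1 -> t * t' < 0 -> sign_fun y ->
  (forall x, 0 <= F f x * y x) \/ (forall x, 0 <= F f' x * y x).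
Proof.
move=> fE f'E t1 t'1 tt' sy.
have [tG|tG] := leP 0 (t * G y b); [left|right].
  exact: point_sign_ge0 tG.
apply: (point_sign_ge0 f'E) => //.
by case: (sign_preimage sy b) => yb; rewrite yb in tG *; nra.
Qed.

(* A sign function can be prescribed independently at two distinct points, one of
   them isolated, so the supports of [F f] and [F f'] are the same singleton. *)
Lemma opposite_points_support b t t' f f' s x :
  (forall x, f x = if x == b then t else 0) ->
  (forall x, f' x = if x == b then t' else 0) ->
  `|t| <= 1 -> `|t'| <= 1 -> t * t' < 0 ->
  isolated_pt s -> F f' s != 0 -> F f x != 0 -> x = s.
Proof.
move=> fE f'E t1 t'1 tt' is_ Fs Fx; apply: contrapT => /eqP xs.
have [w ww wx] := sign_neg Fx; have [w' ww' wx'] := sign_neg Fs.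
have [|y0 y0E] := @bc_cst R K w; first by case: ww => ->; rewrite ?normrN normr1.
have [|y sy yE] := @sign_fun_update R K hK y0 s w' _ is_ ww'.
  by move=> z; rewrite y0E.
case: (opposite_points fE f'E t1 t'1 tt' sy) => [/(_ x)|/(_ s)]; rewrite yE.
  by rewrite (negbTE xs) y0E leNgt wx.
by rewrite eqxx leNgt wx'.
Qed.

Lemma opposite_points_sign b t t' f f' s :
  (forall x, f x = if x == b then t else 0) ->
  (forall x, f' x = if x == b then t' else 0) ->
  `|t| <= 1 -> `|t'| <= 1 -> t * t' < 0 ->
  F f s != 0 -> F f' s != 0 -> F f s * F f' s < 0.
Proof.
move=> fE f'E t1 t'1 tt' Fs F's; have [w ww ws] := sign_neg Fs.
have [|y yE] := @bc_cst R K w; first by case: ww => ->; rewrite ?normrN normr1.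
have sy : sign_fun y by move=> x; rewrite yE.
case: (opposite_points fE f'E t1 t'1 tt' sy) => /(_ s); rewrite yE.
  by rewrite leNgt ws.
move=> ws'; have : F f' s * w != 0.
  by rewrite mulf_neq0//; case: ww => ->; rewrite ?oppr_eq0 oner_eq0.
move: ws ws' => {Fs F's}; case: ww => ->; nra.
Qed.

Lemma point_image_neq0 b t f : (forall x, f x = if x == b then t else 0) ->
  t != 0 -> exists2 s, isolated_pt s & F f s != 0.
Proof.
move=> fE t0; apply: contrapT => nos.
have Ff0 b' : isolated_pt b' -> F f b' = 0.
  by move=> ib; apply/eqP/negPn/negP => ?; apply: nos; exists b'.
have {}Ff0 x : F f x = 0.
  have c0 : continuous (fun _ : K => 0 : R) by exact: cst_continuous.
  apply: le_anti; apply/andP; split.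
    by apply: (le_of_le_isolated dK (@bc_cont _ _ (F f)) c0) => // ? /Ff0 ->.
  by apply: (le_of_le_isolated dK c0 (@bc_cont _ _ (F f))) => // ? /Ff0 ->.
have [|z zE] := @bc_cst R K 0; first by rewrite normr0.
have : F f = F z by apply: bc_ext => x; rewrite Ff0 (nonexp0 zE).
move=> /(congr1 G); rewrite !FK => /(congr1 (fun g : BC R K => g b)).
by rewrite fE eqxx zE => /eqP; rewrite (negbTE t0).
Qed.

(** [F] carries nonzero multiples of the indicator of [b] to nonzero multiples of that of [s], with
    signs twisted by [e]; the modulus of [v] is left open. *)
Definition point_to b s (e : R) := forall t f, `|t| <= 1 -> t != 0 ->
  (forall x, f x = if x == b then t else 0) ->
  exists2 v, 0 < e * t * v & forall x, F f x = if x == s then v else 0.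

(** The images of the indicator of [b] and of its negative have the same one-point support [s]; any
    other multiple is compared with whichever of the two has the opposite sign. *)
Lemma point_image b : isolated_pt b -> exists s, exists e : R,
  [/\ isolated_pt s, e = 1 \/ e = -1, point_to b s e &
      forall y, sign_fun y -> G y b = e * y s].
Proof.
move=> ib.
have n1 : `|1 : R| <= 1 by rewrite normr1.
have nN1 : `|-1 : R| <= 1 by rewrite normrN normr1.
have [p pE] := bc_point hK ib n1; have [m mE] := bc_point hK ib nN1.
have [s is_ ms] : exists2 s, isolated_pt s & F m s != 0.
  by apply: point_image_neq0 mE _; rewrite oppr_eq0 oner_eq0.
have [s' _ ps'] : exists2 s, isolated_pt s & F p s != 0.
  by apply: point_image_neq0 pE _; rewrite oner_eq0.
have N1 : 1 * -1 < 0 :> R by lra.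
have ss' : s' = s := opposite_points_support pE mE n1 nN1 N1 is_ ms ps'.
rewrite {}ss' in ps'.
have pm := opposite_points_sign pE mE n1 nN1 N1 ps' ms.
have [e ee ep] : exists2 e : R, e = 1 \/ e = -1 & 0 < e * F p s.
  by have [w ww wp] := sign_neg ps'; exists (- w); [case: ww => ->; lra|lra].
exists s, e; split => //.
  move=> t f t1 t0 fE; have [s'' _ fs''] := point_image_neq0 fE t0.
  case: (ltgtP t 0) t0 => // t0 _.
    have t10 : t * 1 < 0 by lra.
    have supp x := @opposite_points_support _ _ _ _ _ s x fE pE t1 n1 t10 is_ ps'.
    have {}fs'' : F f s != 0 by rewrite -(supp _ fs'').
    exists (F f s); last first.
      move=> x; case: eqP => [->//|/eqP xs].
      by apply/eqP/negPn/negP => /supp/eqP; rewrite (negbTE xs).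
    have := opposite_points_sign fE pE t1 n1 t10 fs'' ps'.
    by case: ee => ee; rewrite ee in ep *; nra.
  have t10 : t * -1 < 0 by lra.
  have supp x := @opposite_points_support _ _ _ _ _ s x fE mE t1 nN1 t10 is_ ms.
  have {}fs'' : F f s != 0 by rewrite -(supp _ fs'').
  exists (F f s); last first.
    move=> x; case: eqP => [->//|/eqP xs].
    by apply/eqP/negPn/negP => /supp/eqP; rewrite (negbTE xs).
  have fm := opposite_points_sign fE mE t1 nN1 t10 fs'' ms.
  have {}fm : 0 < e * F f s.
    by case: ee => ee; rewrite ee in ep *; nra.
  by rewrite mulrAC mulr_gt0.
move=> y sy; case: (sign_preimage sy b) => yb; rewrite yb.
  have : 0 <= F p s * y s.
    by apply: (point_sign_ge0 pE n1 sy); rewrite yb mulr1.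
  by case: ee => ee; rewrite ee in ep *; case: (sy s) => ->; lra.
have : 0 <= F m s * y s.
  by apply: (point_sign_ge0 mE nN1 sy); rewrite yb; lra.
case: ee => ee; rewrite ee in ep *; case: (sy s) => -> //; nra.
Qed.

(* [F] maps the segments through [b] and [b'] continuously into the segment
   through [s]; by the intermediate value theorem their images would overlap. *)
Lemma point_to_inj_le b b' s (e e' v v' : R) (p p' : BC R K) : isolated_pt b ->
  e = 1 \/ e = -1 -> e' = 1 \/ e' = -1 -> point_to b s e -> b <> b' ->
  (forall x, p x = if x == b then e else 0) ->
  (forall x, p' x = if x == b' then e' else 0) ->
  (forall x, F p x = if x == s then v else 0) ->
  (forall x, F p' x = if x == s then v' else 0) ->
  0 < v' -> v' <= v -> False.
Proof.
move=> ib ee ee' be bb' pE p'E Fp Fp' v'0 v'v.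
have e1 : `|e| = 1 by case: ee => ->; rewrite ?normrN normr1.
(* Clamping to [[0, 1]] defines the path [d] from 0 to [p] inside the ball for every real
   parameter. *)
pose cl (t : R) := Num.max 0 (Num.min t 1).
have clE t : [\/ t <= 0 /\ cl t = 0, 0 <= t <= 1 /\ cl t = t | 1 <= t /\ cl t = 1].
  rewrite /cl; have [t1|t1] := leP t 1.
    have [t0|/ltW t0] := leP t 0; first by constructor 1.
    by constructor 2; rewrite t0.
  by constructor 3; rewrite (ltW t1) max_r// ler01.
have cl01 t : 0 <= cl t <= 1 by case: (clE t) => -[? ->]; lra.
have cllip t u : `|cl t - cl u| <= `|t - u|.
  rewrite ler_norml; have := ler_norm (t - u); have := ler_norm (u - t).
  by rewrite (distrC u t); case: (clE t) => -[? ->]; case: (clE u) => -[? ->]; lra.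
have /choice[d dE] : forall t, exists f, forall x, f x = if x == b then e * cl t else 0.
  move=> t; apply: bc_point => //; rewrite normrM e1 mul1r.
  by have /andP[? ?] := cl01 t; rewrite ger0_norm.
pose phi t := F (d t) s.
have philip t u : `|phi t - phi u| <= `|t - u|.
  apply: nonexp_le => // x; rewrite !dE; case: ifP => _; last by rewrite subr0 normr0.
  by rewrite -mulrBr normrM e1 mul1r.
have cphi : continuous phi.
  move=> t; apply/cvgrPdist_lt => eps eps0.
  have : nbhs t (ball t eps) by exact: nbhsx_ballx.
  by apply: filterS => u; apply: le_lt_trans; exact: philip.
have cl0 : cl 0 = 0 by case: (clE 0) => -[? ->]; lra.
have cl1 : cl 1 = 1 by case: (clE 1) => -[? ->]; lra.
have phi0 : phi 0 = 0.
  by apply: nonexp0 => x; rewrite dE cl0 mulr0 if_same.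
have phi1 : phi 1 = v.
  rewrite /phi; have -> : d 1 = p by apply: bc_ext => x; rewrite dE pE cl1 mulr1.
  by rewrite Fp eqxx.
have [|t t01 phit] := @IVT R phi 0 1 v' ler01 (continuous_subspaceT cphi).
  rewrite phi0 phi1 ge_min le_max (ltW v'0) v'v orbT.
  by [].
have clt : cl t != 0.
  apply/eqP => clt; move: v'0; rewrite -phit.
  by rewrite /phi nonexp0 ?ltxx// => x; rewrite dE clt mulr0 if_same.
(* Both images are supported at [s] with value [v']; yet [d t] vanishes at [b'] while [p'] does
   not. *)
have Fd : F (d t) = F p'.
  apply: bc_ext => x; have [||u _ uE] := be (e * cl t) (d t) _ _ (dE t).
  - by rewrite normrM e1 mul1r; have /andP[? ?] := cl01 t; rewrite ger0_norm.
  - by rewrite mulf_neq0// -normr_eq0 e1 oner_eq0.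
  - have us : u = v' by have := uE s; rewrite eqxx -/(phi t) phit.
    by rewrite uE Fp' us.
have /(congr1 (fun g : BC R K => g b')) := congr1 G Fd.
rewrite !FK dE p'E eqxx; case: eqP => [/esym//|_].
by case: ee' => -> /eqP; rewrite eq_sym ?oppr_eq0 oner_eq0.
Qed.

Lemma point_to_inj b b' s (e e' : R) : isolated_pt b -> isolated_pt b' ->
  e = 1 \/ e = -1 -> e' = 1 \/ e' = -1 ->
  point_to b s e -> point_to b' s e' -> b = b'.
Proof.
move=> ib ib' ee ee' be be'; apply: contrapT => bb'.
have e1 : `|e| = 1 by case: ee => ->; rewrite ?normrN normr1.
have e'1 : `|e'| = 1 by case: ee' => ->; rewrite ?normrN normr1.
have e0 : e != 0 by rewrite -normr_eq0 e1 oner_eq0.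
have e'0 : e' != 0 by rewrite -normr_eq0 e'1 oner_eq0.
have [|p pE] := @bc_point R K hK b e ib; first by rewrite e1.
have [|p' p'E] := @bc_point R K hK b' e' ib'; first by rewrite e'1.
have [|v v0 Fp] := be e p _ e0 pE; first by rewrite e1.
have [|v' v'0 Fp'] := be' e' p' _ e'0 p'E; first by rewrite e'1.
have {}v0 : 0 < v by case: ee => ee; rewrite ee in v0 *; lra.
have {}v'0 : 0 < v' by case: ee' => ee'; rewrite ee' in v'0 *; lra.
have [v'v|/ltW vv'] := leP v' v.
  exact: point_to_inj_le pE p'E Fp Fp' v'0 v'v.
by apply: point_to_inj_le p'E pE Fp' Fp v0 vv' => // /esym.
Qed.

(** [point_image] defines [sigma] on isolated points and a cluster point extends it; sign functions
    of clopen sets then yield continuity. Taking [y = 1] forces [e = G 1]. *)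
Lemma representation : exists e : BC R K, exists sigma : K -> K,
  [/\ sign_fun e, continuous sigma,
      forall y, sign_fun y -> forall x, G y x = e x * y (sigma x),
      forall b, isolated_pt b ->
        isolated_pt (sigma b) /\ point_to b (sigma b) (e b) &
      forall b x, isolated_pt b -> sigma x = sigma b -> x = b].
Proof.
have [|one oneE] := @bc_cst R K 1; first by rewrite normr1.
have sone : sign_fun one by move=> x; left.
pose e := G one; have se : sign_fun e := sign_preimage sone.
have img b : isolated_pt b -> exists s, [/\ isolated_pt s, point_to b s (e b) &
    forall y, sign_fun y -> G y b = e b * y s].
  move=> ib; have [s [e' [is_ ee' be yE]]] := point_image ib.
  have ebE : e b = e' by rewrite /e yE// oneE mulr1.
  by exists s; rewrite ebE.
have /choice[tau tauP] : forall b, exists s, isolated_pt b ->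
    [/\ isolated_pt s, point_to b s (e b) &
    forall y, sign_fun y -> G y b = e b * y s].
  by move=> b; have [/img[s sP]|nb] := pselect (isolated_pt b); [exists s|exists b].
have nearsign y x : sign_fun y -> \forall z \near x, y z = y x.
  move=> sy; have : \forall z \near x, `|y x - y z| < 1.
    by have /cvgrPdist_lt := @bc_cont _ _ y x; apply.
  apply: filterS => z; rewrite ltr_norml.
  by case: (sy x) (sy z) => -> [] ->; lra.
have ext x : exists z, (isolated_pt x -> z = tau x) /\
    forall y, sign_fun y -> G y x = e x * y z.
  have [ix|nix] := pselect (isolated_pt x).
    by exists (tau x); split => //; have [] := tauP _ ix.
  (* [z] is a cluster point of [tau b] as the isolated point [b] tends to [x]. *)
  pose H := tau @ (within [set b | isolated_pt b] (nbhs x)).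
  have PW : ProperFilter (within [set b : K | isolated_pt b] (nbhs x)).
    apply: Build_ProperFilter_ex => A; rewrite /within /=.
    by move=> /(isolated_near dK)[b ib Ab]; exists b; exact: Ab.
  have [z [_ clz]] := cK (fmap_proper_filter tau PW) filterT.
  exists z; split => // y sy.
  have H1 : H [set w | G y x = e x * y w].
    rewrite /H /fmap /within /=.
    have := nearsign _ x (sign_preimage sy); have := nearsign _ x se.
    apply: filterS2 => b eb yb ib; rewrite -yb -eb.
    by have [_ _] := tauP _ ib; apply.
  by have [w [/= -> ->]] := clz _ _ H1 (nearsign y z sy).
have /choice[sigma sigmaP] := ext.
have csigma : continuous sigma.
  move=> x A /=; rewrite nbhsE => -[U [oU Ux] UA].
  (* [G y] and [e] are locally constant, hence so is the composite of [y] with [sigma]. *)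
  have [C [clC Cx CU]] := bK oU Ux; have [y sy yE] := sign_fun_clopen (R := R) clC.
  have := nearsign _ x (sign_preimage sy); have := nearsign _ x se.
  rewrite /fmap /=; apply: filterS2 => z ez yz; apply/UA/CU.
  have [_ /(_ y sy) zE] := sigmaP z; have [_ /(_ y sy) xE] := sigmaP x.
  move: yz; rewrite zE xE ez => /(congr1 (fun r => e x * r)).
  rewrite !mulrA (sign_fun_sqr _ se) !mul1r !yE (asboolT Cx).
  by case: asboolP => // _ /eqP; rewrite eqNr oner_eq0.
have sigma_iso b : isolated_pt b -> isolated_pt (sigma b) /\ point_to b (sigma b) (e b).
  move=> ib; have [/(_ ib) -> _] := sigmaP b.
  by have [] := tauP _ ib.
exists e, sigma; split => //.
- by move=> y sy x; have [_] := sigmaP x; apply.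
(* Since [sigma b] is isolated, [sigma] is constant near [x], so some isolated point other than [b]
   would also be sent to [sigma b]. *)
- move=> b x ib sxb; apply: contrapT => xb.
  have n1 : nbhs x (sigma @^-1` [set sigma b]).
    by apply: csigma; rewrite sxb; have [] := sigma_iso _ ib.
  have n2 : nbhs x (~` [set b]).
    apply: open_nbhs_nbhs; split => //; apply: closed_openC.
    by have [] := isolated_clopen hK ib.
  have [c ic [/= scb cb]] := isolated_near dK (filterI n1 n2).
  apply: cb; apply: (@point_to_inj c b (sigma b) (e c) (e b)) => //.
    by rewrite -scb; have [] := sigma_iso _ ic.
  by have [] := sigma_iso _ ib.
Qed.

End representation.

(** * Rigidity *)

Section rigidity.
Context {R : realType} {K : topologicalType}.
Hypotheses (cK : compact [set: K]) (hK : hausdorff_space K).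
Hypotheses (bK : clopen_basis K) (dK : dense [set x : K | isolated_pt x]).
Hypothesis KG : Gdelta (@accum_pts K).
Context {F G : BC R K -> BC R K}.
Hypotheses (Fne : bc_non_expansive F) (FK : cancel F G) (GK : cancel G F).
Context {e : BC R K} {sigma : K -> K}.
Hypotheses (se : sign_fun e) (csigma : continuous sigma).
Hypothesis GE : forall y, sign_fun y -> forall x, G y x = e x * y (sigma x).
Hypothesis sigma_iso : forall b, isolated_pt b ->
  isolated_pt (sigma b) /\ point_to (F := F) b (sigma b) (e b).
Hypothesis sigma_inj : forall b x, isolated_pt b -> sigma x = sigma b -> x = b.
Implicit Types (f g h k y : BC R K) (a b x : K).

Lemma continuous_comp_sigma (q : K -> R) : continuous q -> continuous (q \o sigma).
Proof. by move=> cq x; apply: continuous_comp; [exact: csigma|exact: cq]. Qed.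

Lemma lift_continuous h : continuous (fun x => e x * h (sigma x)).
Proof.
move=> x; apply: cvgM; first exact: bc_cont.
exact: (continuous_comp_sigma (@bc_cont _ _ h)).
Qed.

Lemma lift_le1 h x : `|e x * h (sigma x)| <= 1.
Proof. by rewrite normrM (sign_funP _ se) mul1r bc_le1. Qed.

(** The operator [J] of the opening comment, the candidate inverse of [F]; it agrees with [G] on
    sign functions. *)
Definition lift h : BC R K := MkBC (@lift_continuous h) (@lift_le1 h).

Lemma lift_le h k (c : R) : (forall x, `|h x - k x| <= c) ->
  forall x, `|lift h x - lift k x| <= c.
Proof. by move=> hk x; rewrite /= -mulrBr normrM (sign_funP _ se) mul1r. Qed.

Lemma nonexp_lift_le h k (c : R) : 0 <= c -> (forall x, `|h x - k x| <= c) ->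
  forall x, `|F (lift h) x - F (lift k) x| <= c.
Proof. by move=> c0 hk; apply: nonexp_le => //; exact: lift_le. Qed.

Lemma lift_sign y : sign_fun y -> F (lift y) = y.
Proof.
by move=> sy; rewrite -[RHS]GK; congr F; apply: bc_ext => x; rewrite GE.
Qed.

Lemma lift_attained f h a : F (lift h) = h ->
  exists x, `|F f a - h a| <= `|f x - lift h x|.
Proof.
move=> Fh; have [x xE] := supdist_attained f (lift h) a cK; exists x.
by rewrite -xE -{1}Fh; apply: le_trans (supdist_ge _ _ _) (Fne _ _).
Qed.

(* Condition (ii) gives this for some [d < 1]; surjectivity of [lift] for [d = 0]. *)
Definition sign_detecting (d : R) := forall f b, isolated_pt b ->
  d < `|F f (sigma b)| -> 0 < f b * e b * F f (sigma b).

(** * Functions fixed by [F] after [lift], above a detection threshold *)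

Section above_threshold.
Context {d : R}.
Hypotheses (d0 : 0 <= d) (dP : sign_detecting d).

(* Compare [f] with the lift of [y] flipped at the single point [sigma b]. *)
Lemma lift_ge f y : sign_fun y -> (forall x, d < F f x * y x) ->
  forall x, F f (sigma x) * y (sigma x) <= f x * e x * y (sigma x).
Proof.
move=> sy dF; have d_ge0 := d0.
have cP : continuous (fun x => f x * e x * y (sigma x)).
  move=> x; apply: cvgM; first by apply: cvgM; exact: bc_cont.
  exact: (continuous_comp_sigma (@bc_cont _ _ y)).
have cr : continuous (fun x => F f (sigma x) * y (sigma x)).
  by move=> x; apply: cvgM; exact: (continuous_comp_sigma (@bc_cont _ _ _)).
have P0 x : 0 <= f x * e x * y (sigma x).
  apply: (le_of_le_isolated dK (@cst_continuous _ _ (0 : R)) cP) => b ib.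
  have dFb := dF (sigma b); have : 0 < f b * e b * F f (sigma b).
    apply: dP => //; apply: (lt_le_trans dFb).
    by rewrite -[leRHS]mulr1 -(sign_funP (sigma b) sy) -normrM ler_norm.
  move: dFb; case: (sy (sigma b)) => ->; rewrite ?mulrN !mulr1 => dFb.
    have F0 : 0 < F f (sigma b) by lra.
    by rewrite pmulr_lgt0// => /ltW.
  have F0 : F f (sigma b) < 0 by lra.
  by rewrite nmulr_lgt0//; lra.
apply: (le_of_le_isolated dK cr cP) => b ib; set s := sigma b.
have [is_ _] := sigma_iso ib.
have [|y' sy' y'E] := @sign_fun_update R K hK y s (- y s) sy is_.
  by case: (sy s) => ->; lra.
have [x] := lift_attained f s (lift_sign sy').
have dFs := dF s; have fx : -1 <= f x <= 1 by rewrite -ler_norml bc_le1.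
(* Since [y'] is opposite to [F f] at [s], the left side is [1 + F f s * y s > 1]. Away from [b] the
   right side is at most 1 by [P0], so [x = b], where it is [1 + f b * e b * y s]. *)
rewrite /= !y'E eqxx; case: eqP => [/(sigma_inj ib) -> |_].
  have := P0 b; rewrite -/s.
  have := ler_norm (F f s - - y s); have := ler_norm (- (F f s - - y s)).
  rewrite normrN; have : `|f b - e b * - y s| = 1 + f b * e b * y s.
    have fb : -1 <= f b <= 1 by rewrite -ler_norml bc_le1.
    apply/eqP; rewrite eqr_norml.
    by case: (se b) (sy s) => -> [] ->; apply/andP; split; try (apply/orP); lra.
  by move=> ->; case: (sy s) => ys; rewrite ys in dFs *; lra.
have := P0 x; have := ler_norm (F f s - - y s); have := ler_norm (- (F f s - - y s)).
rewrite normrN => h1 h2 Px h3; exfalso.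
have : `|f x - e x * y (sigma x)| <= 1.
  by rewrite ler_norml; case: (se x) (sy (sigma x)) Px => -> [] ->; lra.
by case: (sy s) => ys; rewrite ys in dFs h1 h2 h3 *; lra.
Qed.

Section well_ordered.
Context {y : BC R K} {p : K -> R}.
Hypotheses (sy : sign_fun y) (cp : continuous p).
Hypotheses (dp : forall x, d < p x) (p1 : forall x, p x <= 1).
Hypothesis p_clopen : forall a, isolated_pt a -> clopen [set x | p x < p a].
Hypothesis p_inj : forall a x, isolated_pt a -> p x = p a -> x = a.
Hypothesis p_wf : forall A : set K, A !=set0 -> A `<=` @isolated_pt K ->
  exists2 a, A a & forall b, A b -> p a <= p b.

(* The sets [p < p a] are the proper initial segments of a well-order on the
   isolated points; [truncation (p a)] agrees with [y * p] on such a segment, and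
   these functions are shown to be fixed by induction along the order. *)
Definition truncation (t : R) h :=
  forall x, h x = y x * (if p x < t then p x else 1).

Lemma truncation_exists t : clopen [set x | p x < t] -> exists h, truncation t h.
Proof.
move=> clt; have yp1 x : `|y x * p x| <= 1.
  rewrite normrM (sign_funP _ sy) mul1r ger0_norm//.
  exact: le_trans d0 (ltW (dp x)).
have cyp : continuous (fun x => y x * p x).
  by move=> x; apply: cvgM; [exact: bc_cont|exact: cp].
have [h hE] := bc_if (MkBC cyp yp1) y clt; exists h => x.
by rewrite hE /= asboolb; case: ifP => _; rewrite ?mulr1.
Qed.

(** With [f = G h], [lift_ge] gives one inequality between [f] and [lift h]. If it is strict
    somewhere, take the least such [s] and compare [f] with the lift of the truncation at [p s],
    whose value at [s] is [y s] instead of [y s * p s]. *)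
Lemma truncation_fixed_step t h : truncation t h ->
  (forall a k, isolated_pt a -> p a < t -> truncation (p a) k -> F (lift k) = k) ->
  F (lift h) = h.
Proof.
move=> hE IH; pose f := G h; have Ff : F f = h by rewrite GK.
pose r x := if p x < t then p x else 1.
have hyE x : h x * y x = r x by rewrite hE mulrAC (sign_fun_sqr _ sy) mul1r.
pose P x := f x * e x * y (sigma x).
have rP x : r (sigma x) <= P x.
  rewrite -hyE -Ff; apply: lift_ge => // z; rewrite Ff hyE /r.
  by case: ifP => _ //; exact: lt_le_trans (dp z) (p1 z).
have P1 x : P x <= 1.
  apply: le_trans (ler_norm _) _.
  rewrite !normrM (sign_funP _ se) (sign_funP _ sy) !mulr1.
  exact: bc_le1.
have fE x : f x = e x * y (sigma x) * P x.
  by rewrite /P; case: (se x) (sy (sigma x)) => -> [] ->; lra.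
have cP : continuous P.
  move=> x; apply: cvgM; first by apply: cvgM; exact: bc_cont.
  exact: (continuous_comp_sigma (@bc_cont _ _ y)).
have cr : continuous (fun x => r (sigma x)).
  have -> : (fun x => r (sigma x)) = (fun x => h (sigma x) * y (sigma x)).
    by apply/funext => x; rewrite hyE.
  by move=> x; apply: cvgM; exact: (continuous_comp_sigma (@bc_cont _ _ _)).
suff Pr x : P x <= r (sigma x).
  rewrite -[RHS]Ff; congr F; apply: bc_ext => x /=; rewrite fE hE mulrA.
  by congr (_ * _); apply/eqP; rewrite eq_le rP Pr.
apply: (le_of_le_isolated dK cP cr) => {}x ix; rewrite leNgt; apply/negP => rPx.
pose A : set K := [set s | exists b, [/\ isolated_pt b, sigma b = s & r s < P b]].
have [||s [b [ib bs rPb]] smin] := p_wf (A := A).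
- by exists (sigma x), x.
- by move=> _ [b [ib <- _]]; have [] := sigma_iso ib.
have is_ : isolated_pt s by rewrite -bs; have [] := sigma_iso ib.
have [pst rsE ps1] : [/\ p s < t, r s = p s & p s < 1].
  have := lt_le_trans rPb (P1 b); rewrite /r; case: ifP => //.
  by rewrite ltxx.
have [k kE] := truncation_exists (p_clopen is_).
have [z] := lift_attained f s (IH _ _ is_ pst kE).
rewrite Ff hE kE ltxx pst /= kE fE -mulrA -!mulrBr !normrM.
rewrite !(sign_funP _ sy) (sign_funP _ se) !mul1r distrC [`|1 - p s|]ger0_norm; last by lra.
(* If [sigma z] precedes [s], minimality of [s] makes the right side 0, below [1 - p s]. Otherwise
   [P z <= p s], which forces [sigma z = s], hence [z = b], against the choice of [b]. *)
case: ltP => pz.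
  have Pz : P z <= r (sigma z).
    rewrite leNgt; apply/negP => rPz.
    have n1 : nbhs z [set c | 0 < P c - r (sigma c)].
      have cv : (P c - r (sigma c)) @[c --> z] --> P z - r (sigma z).
        by apply: cvgB; [exact: cP|exact: cr].
      by apply: (cvgr_gt _ cv); rewrite subr_gt0.
    have n2 : nbhs z [set c | p (sigma c) < p s].
      have cv : p (sigma c) @[c --> z] --> p (sigma z).
        exact: (continuous_comp_sigma cp).
      exact: (cvgr_lt _ cv).
    have [c ic [/= rPc]] := isolated_near dK (filterI n1 n2).
    by rewrite ltNge smin//; exists c; split => //; rewrite -subr_gt0.
  have : r (sigma z) = p (sigma z) by rewrite /r (lt_trans pz pst).
  have := rP z => h1 h2; rewrite (_ : P z = p (sigma z)) ?subrr ?normr0; first by lra.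
  by apply/eqP; rewrite eq_le -h2 Pz.
rewrite distrC ger0_norm ?subr_ge0// => Pz.
have Pzs : P z <= p s by lra.
have rzs := le_trans (rP z) Pzs.
have : p (sigma z) <= p s.
  move: rzs; rewrite /r; case: ifP => // _; lra.
move=> pzs; have /(p_inj is_) : p (sigma z) = p s by apply: le_anti; rewrite pzs.
rewrite -bs => /(sigma_inj ib) zb.
by move: rPb; rewrite rsE -zb ltNge Pzs.
Qed.

Lemma well_ordered_fixed h : (forall x, h x = y x * p x) -> F (lift h) = h.
Proof.
(* As [p <= 1 < 2], truncating at 2 changes nothing; the induction hypothesis comes from a least
   counterexample. *)
move=> hE; apply: (@truncation_fixed_step 2).
  by move=> x; rewrite hE (le_lt_trans (p1 x))// ltr1n.
move=> a k ia _ ka; apply: contrapT => nk.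
pose A : set K := [set a | isolated_pt a /\ exists2 k, truncation (p a) k & F (lift k) <> k].
have [||b [ib [k' k'E nk']] bmin] := p_wf (A := A).
- by exists a; split => //; exists k.
- by move=> ? [].
apply: nk'; apply: truncation_fixed_step k'E _ => c l ic cb lE.
apply: contrapT => nl; move: cb; rewrite ltNge bmin//.
by split => //; exists l.
Qed.

End well_ordered.

Lemma fixed_above h y (eps : R) : sign_fun y -> 0 < eps ->
  (forall x, d + eps <= h x * y x) -> F (lift h) = h.
Proof.
move=> sy eps0 hy; have d_ge0 := d0; apply: bc_ext => x; apply/eqP.
rewrite -subr_eq0 -normr_le0; apply/ler_addgt0Pr => eta eta0; rewrite add0r.
pose q z := h z * y z.
have cq : continuous q by move=> z; apply: cvgM; exact: bc_cont.
have hle z : -1 <= h z <= 1 by rewrite -ler_norml bc_le1.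
have q01 z : 0 <= q z <= 1.
  have := hy z; rewrite -/(q z) => ?; apply/andP; split; first by lra.
  by have := hle z; rewrite /q; case: (sy z) => ->; lra.
(* The bound [eps / 2] keeps [p] above [d]; [eta / 2] is paid twice, before and after applying
   [F]. *)
pose nu := Num.min (eta / 2) (eps / 2).
have nu0 : 0 < nu by rewrite lt_min; apply/andP; split; lra.
have nueta : nu <= eta / 2 by rewrite ge_min lexx.
have nueps : nu <= eps / 2 by rewrite ge_min lexx orbT.
have [p [cp qp p1 pclo pwf]] := well_ordered_approx cK hK bK KG cq q01 nu0.
have dp z : d < p z.
  by have := qp z; rewrite ler_norml; have := hy z; rewrite -/(q z); lra.
have cyp : continuous (fun z => y z * p z).
  by move=> z; apply: cvgM; [exact: bc_cont|exact: cp].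
have yp1 z : `|y z * p z| <= 1.
  rewrite normrM (sign_funP _ sy) mul1r ger0_norm//.
  exact: le_trans d0 (ltW (dp z)).
pose k := MkBC cyp yp1.
have Fk : F (lift k) = k.
  apply: (well_ordered_fixed sy cp dp p1) => //.
  - by move=> a /pclo[].
  - by move=> a z /pclo[_]; apply.
have hk z : `|h z - k z| <= nu.
  have -> : h z - k z = y z * (q z - p z).
    by rewrite /q /=; case: (sy z) => ->; lra.
  by rewrite normrM (sign_funP _ sy) mul1r.
have := nonexp_lift_le (ltW nu0) hk x; rewrite Fk.
by have := hk x; rewrite !ler_norml; lra.
Qed.

(* The shifts [g + r] and [g - r] are fixed by [fixed_above], and their distance
   to [g] pins [F (lift g)] from both sides. *)
Lemma fixed_small g : d < 1 -> (forall x, `|g x| <= (1 - d) / 4) ->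
  F (lift g) = g.
Proof.
move=> d1 gle; have d_ge0 := d0; apply: bc_ext => x; pose r := d + (1 - d) / 2.
(* As [r] is the midpoint of [d] and 1, the functions [g + r] and [g - r] have modulus at least
   [d + (1 - d) / 4] and at most 1. *)
have gle' z : - ((1 - d) / 4) <= g z <= (1 - d) / 4 by rewrite -ler_norml.
have shift (w : R) : w = 1 \/ w = -1 -> `|F (lift g) x - (g x + w * r)| <= r.
  move=> ww.
  have ch : continuous (fun z => g z + w * r).
    by move=> z; apply: cvgD; [exact: bc_cont|exact: cvg_cst].
  have h1 z : `|g z + w * r| <= 1.
    by rewrite ler_norml /r; have := gle' z; case: ww => ->; lra.
  have [|y yE] := @bc_cst R K w; first by case: ww => ->; rewrite ?normrN normr1.
  have sy : sign_fun y by move=> z; rewrite yE.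
  have := @fixed_above (MkBC ch h1) y ((1 - d) / 4) sy.
  move=> Fh; rewrite -[g x + w * r]/(MkBC ch h1 x) -Fh.
  - apply: nonexp_lift_le; first by rewrite /r; lra.
    move=> z /=; rewrite ler_norml /r; case: ww => ->; lra.
  - by lra.
  - by move=> z; rewrite yE /= /r; have := gle' z; case: ww => ->; lra.
have := shift 1 (or_introl erefl); have := shift (-1) (or_intror erefl).
by rewrite !ler_norml; lra.
Qed.

(** [F] maps [t * f] to a function small enough for [fixed_small], so [t * f] is a lift; divide by
    [t]. *)
Lemma lift_surjective_of_detecting : d < 1 -> forall f, exists h, lift h = f.
Proof.
move=> d1 f; have d_ge0 := d0; pose t := (1 - d) / 4; have t0 : 0 < t by rewrite /t; lra.
have [|c cE] := @bc_cst R K t; first by rewrite gtr0_norm// /t; lra.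
have [tf tfE] := bc_mul f c.
have Fle : forall x, `|F tf x| <= t.
  apply: (nonexp_norm_le Fne GK); first exact: ltW.
  by move=> x; rewrite tfE cE normrM (gtr0_norm t0) ler_piMl ?bc_le1// ltW.
have /(congr1 G) := fixed_small d1 Fle; rewrite !FK => tfl.
have ch : continuous (fun x => F tf x / t).
  by move=> x; apply: cvgM; [exact: bc_cont|exact: cvg_cst].
have h1 x : `|F tf x / t| <= 1.
  by rewrite normrM normfV (gtr0_norm t0) ler_pdivrMr// mul1r.
exists (MkBC ch h1); apply: bc_ext => x /=.
have : lift (F tf) x = f x * t by rewrite tfl tfE cE.
by rewrite /= mulrA => ->; rewrite mulfK// gt_eqF.
Qed.

End above_threshold.

(** * From surjectivity of [lift] to isometry *)

(** Were the sign wrong at [s], a sign function [y] almost agreeing with [h] in sign, but opposite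
    to [F (lift h)] at [s], would be further from [F (lift h)] than from [h]. *)
Lemma detecting0_of_lift_surjective :
  (forall f, exists h, lift h = f) -> sign_detecting 0.
Proof.
move=> lsurj f b ib; have [h <-] := lsurj f; set s := sigma b.
rewrite normr_gt0 => Fs.
have [is_ _] := sigma_iso ib.
have -> : lift h b * e b = h s by rewrite /= mulrAC (sign_fun_sqr _ se) mul1r.
rewrite ltNge; apply/negP => hF.
have [w ww wF] := sign_neg Fs.
have wF0 : 0 < - (F (lift h) s * w) by lra.
have [y0 sy0 y0P] := almost_sign cK bK h (e := - (F (lift h) s * w) / 2) ltac:(lra).
have [y sy yE] := sign_fun_update hK sy0 is_ ww.
have := nonexp_lift_le (h := h) (k := y) (c := 1 - F (lift h) s * w / 2).
rewrite (lift_sign sy) => /(_ ltac:(lra)) H.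
have : `|F (lift h) s - y s| <= 1 - F (lift h) s * w / 2.
  apply: H => x; have hx : -1 <= h x <= 1 by rewrite -ler_norml bc_le1.
  rewrite yE; case: eqP => [->|_]; rewrite ler_norml.
    have hs : -1 <= h s <= 1 by rewrite -ler_norml bc_le1.
    by case: ww => ww; rewrite ww in wF wF0 *; nra.
  by have := y0P x; case: (sy0 x) => ->; lra.
rewrite yE eqxx ler_norml; case: ww => ww; rewrite ww in wF wF0 *; lra.
Qed.

Lemma fixed_of_detecting0 : sign_detecting 0 -> forall g, F (lift g) = g.
Proof.
move=> dP g; apply: bc_ext => x; apply/eqP.
rewrite -subr_eq0 -normr_le0; apply/ler_addgt0Pr => eta eta0; rewrite add0r.
(* For [h = (1 - 2 * nu) * g + 2 * nu * y] one gets [h * y >= nu] and [|g - h| <= 4 * nu], the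
   latter paid twice. *)
pose nu := Num.min (eta / 8) (2^-1).
have nu0 : 0 < nu by rewrite lt_min; apply/andP; split; lra.
have nueta : nu <= eta / 8 by rewrite ge_min lexx.
have nu2 : nu <= 2^-1 by rewrite ge_min lexx orbT.
have [y sy yP] := almost_sign cK bK g nu0.
have gle z : -1 <= g z <= 1 by rewrite -ler_norml bc_le1.
have ch : continuous (fun z => (1 - 2 * nu) * g z + 2 * nu * y z).
  by move=> z; apply: cvgD; apply: cvgM; (exact: cvg_cst || exact: bc_cont).
have h1 z : `|(1 - 2 * nu) * g z + 2 * nu * y z| <= 1.
  by rewrite ler_norml; have := gle z; case: (sy z) => ->; nra.
pose h := MkBC ch h1.
have Fh : F (lift h) = h.
  apply: (@fixed_above 0 (lexx 0) dP h y nu) => // z; rewrite add0r /=.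
  by have := yP z; have := gle z; case: (sy z) => ->; nra.
have gh z : `|g z - h z| <= 4 * nu.
  by rewrite ler_norml /=; have := gle z; case: (sy z) => ->; nra.
have := nonexp_lift_le (c := 4 * nu) ltac:(lra) gh x; rewrite Fh.
by have := gh x; rewrite !ler_norml; lra.
Qed.

(** [lift] then inverts [F], and it does not increase distances either. *)
Lemma isometry_of_lift_surjective :
  (forall f, exists h, lift h = f) -> bc_isometry F.
Proof.
move=> /detecting0_of_lift_surjective/fixed_of_detecting0 Fl f g.
have lF f' : lift (F f') = f' by have /(congr1 G) := Fl (F f'); rewrite !FK.
apply/eqP; rewrite eq_le Fne /=.
have [[x0]|K0] := pselect (exists x : K, True); last first.
  have E (h h' : K -> R) : supdist h h' = sup set0.
    congr (sup _); apply/seteqP; split => // ? [x _ _].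
    by exfalso; apply: K0; exists x.
  by rewrite !E.
suff : supdist (lift (F f)) (lift (F g)) <= supdist (F f) (F g) by rewrite !lF.
apply: supdist_le; first exact: le_trans (normr_ge0 _) (supdist_ge _ _ x0).
by apply: lift_le => x; exact: supdist_ge.
Qed.

(** * Surjectivity of [lift] under either assumption *)

(** Choose [w] so that [F g] is opposite to [F f] at [sigma b]. The wrong sign of [f b] puts [f]
    within 1 of [g], so the two moduli at [sigma b] add up to at most 1. *)
Lemma wrong_sign_bound f b : isolated_pt b -> F f (sigma b) != 0 ->
  f b * e b * F f (sigma b) <= 0 -> exists w : R, exists g,
  [/\ w = 1 \/ w = -1, forall x, g x = if x == b then w else 0,
      forall x, `|F g x| <= `|F g (sigma b)|,
      0 < `|F g (sigma b)| & `|F f (sigma b)| + `|F g (sigma b)| <= 1].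
Proof.
move=> ib; set v := F f (sigma b) => v0 fv.
have [u uu uv] := sign_neg v0; pose w := u * e b.
have ww : w = 1 \/ w = -1.
  by rewrite /w; case: uu (se b) => -> [] ->; lra.
have w1 : `|w| = 1 by case: ww => ->; rewrite ?normrN normr1.
have [|g gE] := @bc_point R K hK b w ib; first by rewrite w1.
have [_ /(_ w g)] := sigma_iso ib; rewrite w1 lexx => /(_ isT) [||r r0 Fg] //.
  by rewrite -normr_eq0 w1 oner_eq0.
have Fgs : F g (sigma b) = r by rewrite Fg eqxx.
have ur : 0 < u * r.
  have -> : u * r = e b * w * r by rewrite /w; case: (se b) => ->; lra.
  exact: r0.
exists w, g; rewrite Fgs; split => //.
- by move=> x; rewrite Fg; case: ifP; rewrite ?normr0.
- by rewrite normr_gt0; apply: contraTneq ur => ->; rewrite mulr0 ltxx.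
have : `|v - r| <= 1.
  rewrite /v -Fgs; apply: (nonexp_le Fne) => // x.
  have fx : -1 <= f x <= 1 by rewrite -ler_norml bc_le1.
  rewrite gE; case: eqP => [xb|_]; last by rewrite subr0 bc_le1.
  have : 0 <= f x * w.
    rewrite xb /w; move: fv; case: uu => uE; rewrite uE in uv *.
      move=> fv; have v1 : v < 0 by lra.
      by move: fv; rewrite nmulr_lle0//; lra.
    move=> fv; have v1 : 0 < v by lra.
    by move: fv; rewrite pmulr_lle0//; lra.
  by rewrite ler_norml; case: ww => ->; lra.
have [v1 r1] : `|v| = - (u * v) /\ `|r| = u * r.
  by case: uu => uE; rewrite uE in uv ur *; split;
    [rewrite ltr0_norm; lra|rewrite gtr0_norm; lra|rewrite gtr0_norm; lra|rewrite ltr0_norm; lra].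
by rewrite v1 r1 ler_norml; case: uu => ->; lra.
Qed.

Lemma cond_ii_lift_surjective : cond_ii F -> forall f, exists h, lift h = f.
Proof.
move=> [c c2 cP] f.
have [[b ib]|nb] := pselect (exists b : K, isolated_pt b); last first.
  have noK (x : K) : False.
    by have [b ib _] := isolated_near dK (@filterT _ (nbhs x) _); apply: nb; exists b.
  by exists f; apply: bc_ext => x; case: (noK x).
have norm_point g a : (forall x, `|F g x| <= `|F g (sigma a)|) ->
    supnorm (F g) <= `|F g (sigma a)|.
  move=> Fg; apply: sup_le_ub; first by exists `|F g a|, a.
  by move=> _ [x _ <-].
(* A wrong sign leaves [|F f (sigma b)|] at most [1 - c], since the point functions have images of
   norm at least [c]. *)
apply: (@lift_surjective_of_detecting (Num.max 0 (1 - c))).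
- by rewrite le_max lexx.
- move=> f' a ia; rewrite gt_max => /andP[v0 vc]; rewrite ltNge; apply/negP => fv.
  have [|w [g [ww gE Fg _ le1]]] := wrong_sign_bound ia _ fv.
    by rewrite -normr_gt0.
  have := le_trans (cP a w g ia ww gE) (norm_point g a Fg).
  by lra.
- by rewrite gt_max ltr01 /=; lra.
Qed.

(** Where [|F f| = 1], [wrong_sign_bound] leaves no room for a wrong sign. So if
    [sigma u = sigma v], the sign of [f u * f v] is that of [e u * e v], and the opposite sign is
    requested. *)
Lemma property_star_injective : property_star F -> injective sigma.
Proof.
move=> Fstar u v suv; apply: contrapT => uv; set z := sigma u.
have [|f [fw Fz]] := Fstar u v z (- (e u * e v)) uv.
  by case: (se u) (se v) => -> [] ->; lra.
have pos x : sigma x = z -> 0 <= f x * e x * F f z.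
  move=> sx; rewrite leNgt; apply/negP => fneg.
  have n1 : nbhs x [set c | `|F f (sigma c)| = 1].
    by have := @csigma x [set y | `|F f y| = 1]; rewrite sx; apply.
  have n2 : nbhs x [set c | f c * e c * F f (sigma c) < 0].
    have cv : (f c * e c * F f (sigma c)) @[c --> x] --> f x * e x * F f (sigma x).
      apply: cvgM; first by apply: cvgM; exact: bc_cont.
      exact: (continuous_comp_sigma (@bc_cont _ _ (F f))).
    by apply: (cvgr_lt _ cv); rewrite sx.
  have [c ic [/= Fc fc]] := isolated_near dK (filterI n1 n2).
  have [|w [g [_ _ _ Fg le1]]] := wrong_sign_bound ic _ (ltW fc).
    by rewrite -normr_eq0 Fc oner_eq0.
  by move: le1; rewrite Fc gerDl leNgt Fg.
have pu := pos u erefl; have pv := pos v (esym suv).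
have F1 : F f z = 1 \/ F f z = -1.
  have := nbhs_singleton Fz => /eqP.
  by rewrite eqr_norml ler01 andbT => /orP[]/eqP; [left|right].
move: pu pv fw.
by case: F1 => ->; case: (se u) => ->; case: (se v) => ->; nra.
Qed.

(** A missed isolated point could be flipped in a sign function without changing its lift, against
    [lift_sign]. As the image is closed, [sigma] is onto, hence a homeomorphism, and [lift] can be
    inverted explicitly. *)
Lemma injective_lift_surjective : injective sigma ->
  forall f, exists h, lift h = f.
Proof.
move=> sinj f.
have sclosed (A : set K) : closed A -> closed (sigma @` A).
  move=> cA; apply: (compact_closed hK); apply: continuous_compact.
    exact: continuous_subspaceT.
  exact: subclosed_compact cA cK _.
have ssurj z : exists x, sigma x = z.
  have sD b : isolated_pt b -> exists x, sigma x = b.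
    move=> ib; apply: contrapT => nb.
    have [|y yE] := @bc_cst R K 1; first by rewrite normr1.
    have sy : sign_fun y by move=> x; left.
    have [|y' sy' y'E] := @sign_fun_update R K hK y b (-1) sy ib; first by right.
    have /(congr1 F) : lift y = lift y'.
      apply: bc_ext => x /=; rewrite y'E; case: eqP => // sx.
      by exfalso; apply: nb; exists x.
    rewrite !lift_sign// => /(congr1 (fun g : BC R K => g b)).
    by rewrite yE y'E eqxx; lra.
  apply: contrapT => nz.
  have : nbhs z (~` (sigma @` setT)).
    apply: open_nbhs_nbhs; split; first by apply: closed_openC; exact: sclosed.
    by move=> [x _ xz]; apply: nz; exists x.
  move=> /(isolated_near dK)[b ib]; apply.
  by have [x <-] := sD _ ib; exists x.
have /choice[tau tauK] := ssurj.
have ctau : continuous tau.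
  apply/continuous_closedP => A /sclosed; congr closed; apply/seteqP; split.
    by move=> _ [x Ax <-]; rewrite /preimage /= (_ : tau _ = x)//; exact: sinj.
  by move=> z Az; exists (tau z).
have [ef efE] := bc_mul e f.
have ch : continuous (fun z => ef (tau z)).
  by move=> z; apply: continuous_comp; [exact: ctau|exact: bc_cont].
exists (MkBC ch (fun z => bc_le1 ef (tau z))); apply: bc_ext => x /=.
rewrite efE (_ : tau (sigma x) = x); first by rewrite mulrA (sign_fun_sqr _ se) mul1r.
exact: sinj.
Qed.

End rigidity.

Unset Implicit Arguments.

Theorem theorem5p1 (R : realType) (K : topologicalType)
  (Kcpt : compact [set: K]) (Khaus : hausdorff_space K)
  (K0dim : clopen_basis K)
  (Kiso_dense : dense [set x : K | isolated_pt x])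
  (K'Gdelta : Gdelta (@accum_pts K))
  (F : BC R K -> BC R K) (Fne : bc_non_expansive F) (Fbij : bijective F) :
  (property_star F \/ cond_ii F) -> bc_isometry F.
Proof.
case: Fbij => G FK GK.
have [e [sigma [se cs GE siso sinj]]] :=
  representation Kcpt Khaus K0dim Kiso_dense Fne FK GK.
move=> starVii; apply: (isometry_of_lift_surjective Kcpt Khaus K0dim Kiso_dense
  K'Gdelta Fne FK GK (se := se) (csigma := cs) GE siso sinj).
case: starVii => [/(property_star_injective Khaus Kiso_dense Fne se cs siso)|].
  exact: (injective_lift_surjective Kcpt Khaus Kiso_dense GK se cs GE).
exact: (cond_ii_lift_surjective Kcpt Khaus K0dim Kiso_dense K'Gdelta
  Fne FK GK se cs GE siso sinj).
Qed.
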